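(* Let $P$ be a poset that is an interval order, or a series-parallel order, or a planar poset with a unique minimum element $0$ and a unique maximum element $1$. Then $\operatorname{qn}(P)\leq \operatorname{width}(P)$.
   Context: All posets are finite and nonempty. For elements $a,b$ of a poset $P$, write $a \prec b$ (a cover relation, or cover) if $a<b$ and there is no $c\in P$ with $a<c<b$. $\operatorname{width}(P)$ is the maximum number of pairwise incomparable elements. A linear extension $L$ of $P$ is a linear order on the elements of $P$ such that $x<_L y$ whenever $x<_P y$. A rainbow of size $k$ (a $k$-rainbow) with respect to $L$ is a set of $k$ covers $a_1\prec b_1,\dots,a_k\prec b_k$ of $P$ with $a_1<_L\cdots<_L a_k<_L b_k<_L\cdots<_L b_1$. The queue-number $\operatorname{qn}(P)$ is the smallest $k$ such that there is a linear extension $L$ of $P$ with respect to which the covers of $P$ contain no $(k+1)$-rainbow. An interval order is a poset whose elements can be represented by closed real intervals so that $x<y$ if and only if the interval of $x$ lies entirely to the left of that of $y$; equivalently, it has no induced subposet 2+2 (four elements $a,b,c,d$ with only the relations $a<b$, $c<d$). A series-parallel order is a poset obtained from one-element posets by repeatedly taking disjoint unions (parallel composition) and ordinal sums (series composition); equivalently, it has no induced subposet N (four elements $a,b,c,d$ with only the relations $a<b$, $c<d$, $c<b$). An element $0$ (respectively $1$) of $P$ is an element with $0\leq x$ (respectively $x\leq 1$) for all $x\in P$. A diagram of $P$ represents the elements as distinct points in the plane and each cover $a\prec b$ as a $y$-monotone curve going upwards from $a$ to $b$ (not passing through points of other elements). A poset is planar if it admits a crossing-free diagram, i.e. one in which distinct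 curves meet only in common endpoints. *)

(* Defs.v *)
From HB Require Import structures.
From mathcomp Require Import all_boot all_order all_algebra.
From mathcomp Require Import all_classical all_reals all_analysis.

Set Implicit Arguments.
Unset Strict Implicit.
Unset Printing Implicit Defensive.

Import Order.TTheory GRing.Theory Num.Theory.
Import numFieldNormedType.Exports.

Local Open Scope order_scope.

Section QueueNumber.
Context {d : Order.disp_t} (P : finPOrderType d).

Definition covers (a b : P) : bool :=
  (a < b) && [forall c : P, ~~ ((a < c) && (c < b))].

Definition antichain (A : {set P}) : bool :=
  [forall x in A, forall y in A, (x != y) ==> (x >< y)].

Definition width : nat := (\max_(A : {set P} | antichain A) #|A|)%N.

(* The relation L is the strict order <_L. *)
Definition linear_extension (L : rel P) : Prop :=
  [/\ irreflexive L,
      transitive L,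
      (forall x y, x != y -> L x y || L y x)
    & forall x y, x < y -> L x y].

(* s = (a_1, b_1), ..., (a_k, b_k) with a_1 <_L ... <_L a_k <_L b_k <_L ...
   <_L b_1. *)
Definition rainbow (L : rel P) (k : nat) (s : k.-tuple (P * P)) : Prop :=
  (forall ab, ab \in s -> covers ab.1 ab.2)
  /\ sorted L ([seq ab.1 | ab <- s] ++ rev [seq ab.2 | ab <- s]).

Definition queue_layout (k : nat) : Prop :=
  exists2 L : rel P, linear_extension L
    & ~ exists s : k.+1.-tuple (P * P), rainbow L s.

Lemma exists_linear_extension : exists L : rel P, linear_extension L.
Proof.
pose h (x : P) := #|[set z : P | z <= x]|.
have h_lt x y : x < y -> (h x < h y)%N.
  move=> xy; apply: proper_card; apply/properP; split.
    by apply/fintype.subsetP => z; rewrite !inE => /le_trans; apply; exact: ltW.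
  by exists y; rewrite !inE ?lexx // lt_geF.
exists (fun x y => (h x < h y)%N
  || ((h x == h y) && (enum_rank x < enum_rank y)%N)); split.
- by move=> x; rewrite !ltnn andbF.
- move=> y x z /orP[xy|/andP[/eqP-> xy]] /orP[yz|/andP[/eqP<- yz]].
  + by rewrite (ltn_trans xy yz).
  + by rewrite xy.
  + by rewrite yz.
  + by rewrite eqxx (ltn_trans xy yz) orbT.
- move=> x y; rewrite -(inj_eq enum_rank_inj) -val_eqE /=.
  by case: (ltngtP (h x) (h y)) => //= _; rewrite neq_ltn.
- by move=> x y /h_lt ->.
Qed.

Lemma exists_queue_layout : exists k, `[< queue_layout k >].
Proof.
have [L Llin] := exists_linear_extension.
exists #|P|; apply/asboolP; exists L => // -[s [_]].
have [irrL trL _ _] := Llin.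
move=> /(sorted_uniq trL irrL); rewrite cat_uniq => /andP[/card_uniqP us _].
have := max_card (mem [seq ab.1 | ab <- s]).
by rewrite us size_map size_tuple ltnn.
Qed.

Definition queue_number : nat := ex_minn exists_queue_layout.

End QueueNumber.

Definition interval_order (R : realType) {d : Order.disp_t}
    (P : finPOrderType d) : Prop :=
  exists l r : P -> R,
    (forall x, (l x <= r x)%R) /\ (forall x y, (x < y) = (r x < l y)%R).

Definition disjoint_union (T U : Type) (r : rel T) (s : rel U) : rel (T + U) :=
  fun x y => match x, y with
  | inl a, inl b => r a b
  | inr a, inr b => s a b
  | _, _ => false
  end.

Definition ordinal_sum (T U : Type) (r : rel T) (s : rel U) : rel (T + U) :=
  fun x y => match x, y with
  | inl a, inl b => r a b
  | inr a, inr b => s a b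
  | inl _, inr _ => true
  | inr _, inl _ => false
  end.

(* The class of non-strict order relations, on arbitrary carriers, closed under
   isomorphism. *)
Inductive series_parallel_rel : forall T : Type, rel T -> Prop :=
| SPPoint : series_parallel_rel (fun _ _ : unit => true)
| SPParallel (T U : Type) (r : rel T) (s : rel U) :
    series_parallel_rel r -> series_parallel_rel s ->
    series_parallel_rel (disjoint_union r s)
| SPSeries (T U : Type) (r : rel T) (s : rel U) :
    series_parallel_rel r -> series_parallel_rel s ->
    series_parallel_rel (ordinal_sum r s)
| SPIso (T U : Type) (r : rel T) (s : rel U) (f : T -> U) :
    bijective f -> (forall x y, s (f x) (f y) = r x y) ->
    series_parallel_rel r -> series_parallel_rel s.

Definition series_parallel {d : Order.disp_t} (P : finPOrderType d) : Prop :=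
  series_parallel_rel (fun x y : P => x <= y).

Definition has_zero_one {d : Order.disp_t} (P : finPOrderType d) : Prop :=
  (exists zero : P, forall x, zero <= x) /\ (exists one : P, forall x, x <= one).

(* A curve is a path [0, 1] -> R^2; its values outside [0, 1], and the values
   of c at pairs that are not covers, are irrelevant. *)
Definition upward_curve (R : realType) (g : R -> R * R) (p q : R * R) : Prop :=
  [/\ {within `[0%R, 1%R], continuous g}%classic,
      g 0%R = p,
      g 1%R = q
    & forall s t : R, (0 <= s)%R -> (s < t)%R -> (t <= 1)%R ->
        ((g s).2 < (g t).2)%R].

Definition diagram (R : realType) {d : Order.disp_t} (P : finPOrderType d)
    (pos : P -> R * R) (c : P -> P -> R -> R * R) : Prop :=
  [/\ injective pos,
      (forall a b, covers a b -> upward_curve (c a b) (pos a) (pos b))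
    & forall a b z (t : R), covers a b -> (0 <= t <= 1)%R ->
        c a b t = pos z -> z = a \/ z = b].

Definition crossing_free (R : realType) {d : Order.disp_t}
    (P : finPOrderType d) (pos : P -> R * R) (c : P -> P -> R -> R * R) : Prop :=
  forall (a b a' b' : P) (s t : R),
    covers a b -> covers a' b' -> (a, b) <> (a', b') ->
    (0 <= s <= 1)%R -> (0 <= t <= 1)%R -> c a b s = c a' b' t ->
    exists v : P, [/\ v = a \/ v = b, v = a' \/ v = b' & c a b s = pos v].

Definition planar (R : realType) {d : Order.disp_t} (P : finPOrderType d)
    : Prop :=
  exists pos : P -> R * R, exists c : P -> P -> R -> R * R,
    diagram pos c /\ crossing_free pos c.

(* Main.v *)
Require Import Defs.
From mathcomp Require Import all_boot all_order all_algebra all_reals.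
From mathcomp Require Import boolp classical_sets set_interval.
From mathcomp Require Import topology normedtype realfun lra.

(** In each case a linear extension [L] is found for which a rainbow
    [(a_1, b_1), ..., (a_n, b_n)] yields an antichain of [n] elements, so that
    [n] is at most the width.

    For interval orders and series-parallel orders, [L] sorts the elements by
    the number of elements below them.  Suppose [a_i < a_j] with [i < j].
    Everything below [b_i] is then below [b_j]: in an interval representation
    [b_i] cannot lie to the right of [a_j], as [a_i] is covered by [b_i], so it
    starts before [b_j] does; in an order without an induced N, an element
    below [b_i] is comparable to [a_i] or to [a_j], and hence lies below [b_j].
    As [a_j] is below [b_j] but not below [b_i], the element [b_i] precedes
    [b_j] in [L], which contradicts the nesting.  Thus the [a_i] form an
    antichain.

    A planar order with [0] and [1] is studied through its maximal chains.  The
    curves of the covers on such a chain make up the graph of a continuous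
    function of the height ([path_graph]).  By the intermediate value theorem,
    two such graphs can only swap sides at a common vertex ([graphs_cross]).
    Hence, for incomparable [x] and [y], whether [x] lies to the left of a chain
    through [y] does not depend on the chain ([left_graph]), and [L], defined by
    [x < y] or [x] left of [y], is a linear extension ([left_order_linear]).
    Swapping sides between the two ends of a cover would put a vertex inside
    that cover ([cover_no_switch]); this excludes crossing pairs of covers
    ([left_order_nocross]) and shows that the upper cover [b] of [a] is the join
    of [a] with any [x < b] incomparable to [a] ([cover_join]).

    In the planar case neither the [a_i] nor the [b_i] need form an antichain:
    for [i < j] exactly one of [a_i < a_j] and [b_j < b_i] holds.  The join
    property shows that, for a fixed [i], it is the same one for all [j > i].
    If it is the first, [b_i] is incomparable to [a_j] and [b_j]; if it is the
    second, [a_i] is.  So choosing [b_i] or [a_i] accordingly gives an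
    antichain ([queue_layout_planar_lattice]). *)

Set Implicit Arguments.
Unset Strict Implicit.
Unset Printing Implicit Defensive.

Import Order.TTheory GRing.Theory Num.Theory.
Import numFieldNormedType.Exports.

Local Open Scope order_scope.

(** * Rainbows and antichains *)

Section Nesting.
Context {d : Order.disp_t} (P : finPOrderType d).
Implicit Types (a b x y z : P) (L : rel P).

Lemma queue_number_le k : queue_layout P k -> (queue_number P <= k)%N.
Proof.
by rewrite /queue_number; case: ex_minnP => m _ m_min /asboolT /m_min.
Qed.

Lemma antichain_width n (f : 'I_n -> P) :
  (forall i j : 'I_n, (i < j)%N -> f i >< f j) -> (n <= width P)%N.
Proof.
move=> f_anti; have f_neq i j : i != j -> f i >< f j.
  rewrite -val_eqE /= neq_ltn => /orP[/f_anti //|/f_anti].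
  by rewrite comparable_sym.
have f_inj : injective f.
  by move=> i j fij; apply/eqP/negP => /negP/f_neq; rewrite fij comparablexx.
rewrite -[X in (X <= _)%N]card_ord -(card_imset _ f_inj).
apply: (leq_bigmax_cond (F := fun A : {set P} => #|A|)).
apply/forall_inP => _ /imsetP[i _ ->]; apply/forall_inP => _ /imsetP[j _ ->].
by apply/implyP => fij; apply: f_neq; apply: contraNneq fij => ->.
Qed.

Lemma covers_lt a b : covers a b -> a < b.
Proof. by case/andP. Qed.

Lemma covers_between a b c : covers a b -> a < c -> c < b -> False.
Proof. by case/andP => _ /forallP/(_ c) /negP nab ac cb; apply: nab; rewrite ac. Qed.

(** A rainbow as two families indexed by the ordinals, with every comparison
    that follows by transitivity made explicit. *)
Definition nested L n (a b : 'I_n -> P) : Prop :=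
  [/\ forall i, covers (a i) (b i),
      forall i j : 'I_n, (i < j)%N -> L (a i) (a j),
      forall i j : 'I_n, (i < j)%N -> L (b j) (b i)
    & forall i j, L (a i) (b j)].

Lemma nested_of_rainbow L n (s : n.-tuple (P * P)) : transitive L -> rainbow L s ->
  nested L (fun i => (tnth s i).1) (fun i => (tnth s i).2).
Proof.
move=> L_trans [s_covers].
rewrite sorted_pairwise // pairwise_cat -!sorted_pairwise //.
case/and3P => /allrelP ab_L; rewrite rev_sorted => a_L b_L; split.
- by move=> i; apply/s_covers/mem_tnth.
- move=> i j ij; have x0 := tnth s i.
  have := sorted_ltn_nth L_trans x0.1 a_L.
  move=> /(_ i j); rewrite !inE size_map size_tuple !ltn_ord.
  rewrite !(nth_map x0) ?size_tuple //.
  by rewrite -!tnth_nth; apply.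
- move=> i j ij; have x0 := tnth s i.
  have L_trans' : transitive (fun x y => L y x).
    by move=> y x z xy yz; exact: L_trans xy.
  have := sorted_ltn_nth L_trans' x0.2 b_L.
  move=> /(_ i j); rewrite !inE size_map size_tuple !ltn_ord.
  rewrite !(nth_map x0) ?size_tuple //.
  by rewrite -!tnth_nth; apply.
- move=> i j; apply: ab_L; first by apply: map_f; apply: mem_tnth.
  by rewrite mem_rev; apply: map_f; apply: mem_tnth.
Qed.

Lemma queue_layout_width L : linear_extension L ->
    (forall n (a b : 'I_n -> P), nested L a b ->
       exists f : 'I_n -> P, forall i j : 'I_n, (i < j)%N -> f i >< f j) ->
  queue_layout P (width P).
Proof.
move=> L_lin L_anti; exists L => // -[s].
case: (L_lin) => _ L_trans _ _ /(nested_of_rainbow L_trans)/L_anti[f /antichain_width].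
by rewrite ltnn.
Qed.

Section LinearExtension.
Variable L : rel P.
Hypothesis L_lin : linear_extension L.

Lemma linext_asym x y : L x y -> L y x -> False.
Proof.
have [L_irr L_trans _ _] := L_lin.
by move=> /L_trans xy /xy; rewrite L_irr.
Qed.

Lemma linext_le x y : L x y -> y <= x -> False.
Proof.
have [L_irr _ _ L_lt] := L_lin; rewrite le_eqVlt => xy /predU1P[yx|].
  by rewrite yx L_irr in xy.
by move/L_lt; exact: linext_asym.
Qed.

Lemma linext_incomparable x y : L x y -> ~ x < y -> x >< y.
Proof.
move=> xy nxy; apply/negP => /orP[|/(linext_le xy)//].
rewrite le_eqVlt => /predU1P[xy'|//]; apply: (linext_le xy).
by rewrite xy'.
Qed.

(** The lower ends of a rainbow are pairwise incomparable, since [a < a'] would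
    put the upper ends in the wrong order. *)
Lemma queue_layout_monotone_covers :
    (forall a b a' b', covers a b -> a < a' -> covers a' b' -> L b b') ->
  queue_layout P (width P).
Proof.
move=> L_nest; apply: (queue_layout_width L_lin) => n a b [ab aL bL _].
exists a => i j ij; apply: linext_incomparable; first exact: aL.
by move=> aij; apply: (linext_asym (bL i j ij)); exact: L_nest (ab i) aij (ab j).
Qed.

(** The two hypotheses are what remains of planarity: of two covers that are
    nested in [L], the lower ends or the upper ends are comparable, and [b] is
    the join of its lower cover [a] with any element below [b] that is
    incomparable to [a].  In a nested pair [i < j] exactly one
    of [a_i < a_j] and [b_j < b_i] holds.  If [a_i < a_k] and [b_j < b_i] with
    [a_i] and [a_j] incomparable, then [a_k] or [b_k] is above both [a_i] and
    [a_j] (unless [b_k] sits below [b_i], so that [a_k] is between [a_i] and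
    [b_i]), hence above [b_i], although [L] places it before [b_i]. *)
Lemma queue_layout_planar_lattice :
    (forall a b a' b', covers a b -> covers a' b' -> L a a' -> L b' b ->
       a < a' \/ b' < b) ->
    (forall a b z t, covers a b -> z < b -> z >< a -> a <= t -> z <= t ->
       b <= t) ->
  queue_layout P (width P).
Proof.
move=> L_nocross L_join; apply: (queue_layout_width L_lin) => n a b [ab aL bL abL].
have [_ L_trans _ _] := L_lin.
have ab_lt i : a i < b i := covers_lt (ab i).
pose up (i : 'I_n) := [exists j : 'I_n, (i < j)%N && (a i < a j)].
(* The end of the i-th cover that avoids all later covers: these are above
   [a i] when [up i] holds, and below [b i] otherwise. *)
exists (fun i => if up i then b i else a i) => i j ij.
have [aij|aij] := boolP (a i < a j).
  have -> : up i by apply/existsP; exists j; rewrite ij.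
  have naib : ~ a j < b i by exact: covers_between (ab i) aij.
  rewrite comparable_sym; case: ifP => _.
    apply: linext_incomparable; first exact: bL.
    by move=> bji; apply: naib; exact: lt_trans (ab_lt j) bji.
  by apply: linext_incomparable; first exact: abL.
have aij_inc : a i >< a j by apply: linext_incomparable; [exact: aL|exact/negP].
have bji : b j < b i.
  have [aij'|//] := L_nocross _ _ _ _ (ab i) (ab j) (aL i j ij) (bL i j ij).
  by rewrite aij' in aij.
case: (boolP (up i)) => [/existsP[k /andP[ik aik]]|_]; last first.
  case: ifP => _ //; apply: linext_incomparable; first exact: abL.
  by move=> aibj; exact: covers_between (ab i) aibj bji.
exfalso.
have ajbi : a j < b i := lt_trans (ab_lt j) bji.
have aji_inc : a j >< a i by rewrite comparable_sym.
have L_up t : a i <= t -> a j <= t -> L t (b i) -> False.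
  by move=> ait ajt /linext_le; apply; exact: L_join (ab i) ajbi aji_inc ait ajt.
have [jk|kj|jk] := ltngtP j k; last first.
- by rewrite (val_inj jk) aik in aij.
- have [akj|bjk] := L_nocross _ _ _ _ (ab k) (ab j) (aL k j kj) (bL k j kj).
    by rewrite (lt_trans aik akj) in aij.
  apply: (L_up (b k)); last exact: bL.
    exact/ltW/(lt_trans aik).
  exact/ltW/(lt_trans (ab_lt j)).
- have [ajk|bkj] := L_nocross _ _ _ _ (ab j) (ab k) (aL j k jk) (bL j k jk).
    by apply: (L_up (a k)); [exact: ltW|exact: ltW|exact: abL].
  apply: (covers_between (ab i) aik).
  exact: lt_trans (ab_lt k) (lt_trans bkj bji).
Qed.

End LinearExtension.

(** * Sorting by the number of smaller elements *)

(** The ranks only break ties between elements with equally many elements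
    below them. *)
Definition down_rel x y :=
  let h z := #|[set w : P | w < z]| in
  (h x < h y)%N || ((h x == h y) && (enum_rank x < enum_rank y)%N).

Lemma down_rel_proper x y : (forall z, z < x -> z < y) ->
  (exists2 z, z < y & ~ z < x) -> down_rel x y.
Proof.
move=> xy [z zy zx]; apply/orP; left; apply: proper_card.
apply/properP; split; first by apply/fintype.subsetP => w; rewrite !inE; exact: xy.
by exists z; rewrite ?inE //; exact/negP.
Qed.

Lemma down_rel_linear : linear_extension down_rel.
Proof.
rewrite /down_rel; split.
- by move=> x; rewrite !ltnn andbF.
- move=> y x z /orP[xy|/andP[/eqP-> xy]] /orP[yz|/andP[/eqP<- yz]].
  + by rewrite (ltn_trans xy yz).
  + by rewrite xy.
  + by rewrite yz.
  + by rewrite eqxx (ltn_trans xy yz) orbT.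
- move=> x y; rewrite -(inj_eq enum_rank_inj) -val_eqE /=.
  by case: (ltngtP #|_| #|_|) => //= _; rewrite neq_ltn.
- move=> x y xy; apply: down_rel_proper; first by move=> z zx; exact: lt_trans xy.
  by exists x => //; rewrite ltxx.
Qed.

(** The common feature of interval orders and series-parallel orders that
    makes [down_rel] suitable. *)
Definition cover_downset_mono : Prop := forall a b a' b' z,
  covers a b -> a < a' -> a' < b' -> z < b -> z < b'.

(** The strict down-set of [b] is contained in that of [b'], and properly so:
    [a'] is below [b'] but not below [b], as [b] covers [a]. *)
Lemma queue_layout_down_rel : cover_downset_mono -> queue_layout P (width P).
Proof.
move=> down_mono; apply: (queue_layout_monotone_covers down_rel_linear).
move=> a b a' b' ab aa' /covers_lt a'b'; apply: down_rel_proper.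
  by move=> z; exact: down_mono ab aa' a'b'.
by exists a' => // a'b; exact: covers_between ab aa' a'b.
Qed.

(** Since [a'] is not below [b], the interval of [b] starts no later than that
    of [a'] ends, hence before that of [b'] starts. *)
Lemma interval_order_cover_downset (R : realType) :
  interval_order R P -> cover_downset_mono.
Proof.
move=> [l [r [lr lt_lr]]] a b a' b' z ab aa' a'b' zb.
have : ~~ (a' < b) by apply/negP; exact: covers_between ab aa'.
rewrite !lt_lr -leNgt in a'b' zb * => ba'.
exact: lt_le_trans zb (le_trans ba' (ltW a'b')).
Qed.

End Nesting.

(** The elements are not required to be distinct: for the reflexive relations
    considered here, an equality among them implies one of the listed
    relations. *)
Definition N_free (T : Type) (r : rel T) : Prop := forall a b a' z,
  r a b -> r a a' -> r z b ->
  [|| r a z, r z a, r a' b, r b a', r z a' | r a' z].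

(** Following the edges and non-edges of an N leads from each of its elements to
    every other one, both in the comparability graph and in its complement.  So
    an N meeting both parts of a union would miss an edge, and one meeting both
    parts of an ordinal sum would miss a non-edge. *)
Lemma series_parallel_N_free (T : Type) (r : rel T) :
  series_parallel_rel r -> N_free r.
Proof.
elim=> {T r} [//|T U r s _ IHr _ IHs|T U r s _ IHr _ IHs|T U r s f [g _ gK] fE _ IHr].
- by move=> [a|a] [b|b] [a'|a'] [z|z] //=; [exact: IHr|exact: IHs].
- by move=> [a|a] [b|b] [a'|a'] [z|z] //=; rewrite ?orbT //; [exact: IHr|exact: IHs].
- move=> a b a' z; rewrite -(gK a) -(gK b) -(gK a') -(gK z) !fE; exact: IHr.
Qed.

(** As [a < b], [a < a'] and [z < b] do not form an N, one of the three pairs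
    that would be incomparable in it is comparable.  Either this puts [z] below
    [b'], or it puts an element strictly between [a] and [b]. *)
Lemma series_parallel_cover_downset (d : Order.disp_t) (P : finPOrderType d) :
  series_parallel P -> cover_downset_mono P.
Proof.
move=> /series_parallel_N_free Nfree a b a' b' z ab aa' a'b' zb.
have a'b : ~ a' < b by exact: covers_between ab aa'.
have /or3P[az|za|] := Nfree a b a' z (ltW (covers_lt ab)) (ltW aa') (ltW zb).
- move: az; rewrite le_eqVlt => /predU1P[<-|az]; first exact: lt_trans a'b'.
  by have := covers_between ab az zb.
- exact: le_lt_trans za (lt_trans aa' a'b').
case/or4P => [|ba'|za'|a'z].
- rewrite le_eqVlt => /predU1P[a'bE|//]; apply: lt_trans zb _.
  by rewrite -a'bE.
- exact: lt_trans zb (le_lt_trans ba' a'b').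
- exact: le_lt_trans za' a'b'.
- by case: a'b; exact: le_lt_trans zb.
Qed.

(** * Upward curves as graphs over the height *)

Section Curves.
Variable R : realType.
Implicit Types (g : R -> R * R) (p q : R * R).

Lemma within_cvg (f : R -> R) (a b x : R) :
    {within `[a, b], continuous f}%classic -> a <= x <= b ->
  (f @ within `[a, b] (nbhs x) --> f x)%classic.
Proof. by move=> /subspace_continuousP; apply. Qed.

(** The height is a strictly increasing continuous function of the parameter, so
    its inverse is continuous and the curve can be parametrized by height. *)
Lemma upward_curve_graph g p q : upward_curve g p q -> exists G : R -> R,
  {within `[p.2, q.2], continuous G}%classic /\
  forall y, p.2 <= y <= q.2 ->
    exists2 t : R, (0 <= t <= 1)%R & g t = (G y, y).
Proof.
move=> [g_cont g0 g1 g_incr].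
pose f t := (g t).2.
have f_cont : {within `[0%R, 1%R], continuous f}%classic.
  apply/subspace_continuousP => t t01.
  apply: (@cvg_comp _ _ _ g snd _ (nbhs (g t))); last exact: cvg_snd.
  by move/subspace_continuousP : g_cont; apply.
have f_surj y : p.2 <= y <= q.2 -> exists2 t : R, (0 <= t <= 1)%R & f t = y.
  move=> ypq; have [||t] := @IVT R f 0%R 1%R y _ f_cont.
  - exact: ler01.
  - by rewrite /f g0 g1 ge_min le_max; case/andP: ypq => -> ->; rewrite orbT.
  - by rewrite in_itv /=; exists t.
have f_inj (s t : R) : (0 <= s <= 1)%R -> (0 <= t <= 1)%R -> f s = f t -> s = t.
  rewrite /f => /andP[s0 s1] /andP[t0 t1] e; case: (ltgtP s t) => // [st|ts].
    by have := g_incr _ _ s0 st t1; rewrite e ltxx.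
  by have := g_incr _ _ t0 ts s1; rewrite e ltxx.
have /choice[k kP] : forall y, exists t : R,
    p.2 <= y <= q.2 -> (0 <= t <= 1)%R /\ f t = y.
  move=> y; case: (boolP (p.2 <= y <= q.2)) => [/f_surj[t]|_]; last by exists 0%R.
  by exists t.
have fpq (t : R) : (0 <= t <= 1)%R -> p.2 <= f t <= q.2.
  rewrite /f => /andP[t0 t1]; rewrite -g0 -g1.
  apply/andP; split.
    move: t0; rewrite le_eqVlt => /predU1P[<- //|t0].
    by apply: ltW; apply: g_incr.
  move: t1; rewrite le_eqVlt => /predU1P[-> //|t1].
  by apply: ltW; apply: g_incr.
have k_cont : {within `[p.2, q.2], continuous k}%classic.
  have -> : p.2 = f 0%R by rewrite /f g0.
  have -> : q.2 = f 1%R by rewrite /f g1.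
  apply: segment_can_le_continuous => //.
  move=> t; rewrite in_itv /= => t01; have [kt fkt] := kP _ (fpq _ t01).
  exact: f_inj.
exists (fun y => (g (k y)).1); split; last first.
  move=> y /kP[k01 fky]; exists (k y) => //.
  by move: fky; rewrite /f; case: (g (k y)) => ? ? /= ->.
apply/subspace_continuousP => y ypq; have [k01 _] := kP y ypq.
apply: (@cvg_comp _ _ _ (g \o k) fst _ (nbhs (g (k y)))); last exact: cvg_fst.
have /subspace_continuousP/(_ _ k01) gk := g_cont.
apply: (@cvg_comp _ _ _ k g _ (within `[0%R, 1%R]%classic (nbhs (k y)))).
  2: exact: gk.
move=> U kU; apply: filterS (within_cvg k_cont ypq kU : nbhs y _) => z kzU zpq.
by apply: (kzU zpq); have [] := kP z zpq.
Qed.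
End Curves.

Lemma IVT_meet (R : realType) (f g : R -> R) (a b : R) :
    {within `[a, b], continuous f}%classic ->
    {within `[a, b], continuous g}%classic ->
    a <= b -> f a <= g a -> g b <= f b ->
  exists2 u, a <= u <= b & f u = g u.
Proof.
move=> f_cont g_cont ab fga gfb.
have fg_cont : {within `[a, b], continuous (fun x => f x - g x)%R}%classic.
  by move=> x; apply: cvgB; [exact: f_cont|exact: g_cont].
have [|u] := @IVT R _ a b 0%R ab fg_cont.
  by rewrite ge_min le_max subr_le0 fga /= !subr_ge0 gfb orbT.
by rewrite in_itv /= => uab /eqP; rewrite subr_eq0 => /eqP; exists u.
Qed.

(** * Paths of covers *)

Section CoverPaths.
Context {d : Order.disp_t} (P : finPOrderType d).
Implicit Types (a b v w x y z : P) (p : seq P).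

(** Induction on the size of the interval between [x] and [y]: either it is a
    cover, or an intermediate element splits it into two smaller intervals. *)
Lemma cover_path_exists x y : x <= y ->
  exists2 p, path (@covers _ P) x p & last x p = y.
Proof.
have [n] := ubnP #|[set z | x <= z <= y]|.
elim: n x y => // n IH x y le_n; rewrite le_eqVlt => /predU1P[->|xy].
  by exists [::].
have [xy_cov|] := boolP (covers x y); first by exists [:: y] => //=; rewrite xy_cov.
rewrite /covers xy negb_forall => /existsP[z /negPn/andP[xz zy]].
have sub_n u v : x <= u -> v <= y -> (u != x) || (v != y) ->
    (#|[set w : P | (u <= w <= v)%O]| < n)%N.
  move=> xu vy uv; rewrite ltnS in le_n; apply: leq_trans le_n; apply: proper_card.
  apply/properP; split.
    apply/fintype.subsetP => w; rewrite !inE => /andP[uw wv].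
    by rewrite (le_trans xu uw) (le_trans wv vy).
  case/orP: uv => [ux|vy'].
    exists x; first by rewrite inE lexx ltW.
    by rewrite inE; apply: contra ux => /andP[ux _]; rewrite eq_le ux.
  exists y; first by rewrite inE lexx ltW.
  by rewrite inE; apply: contra vy' => /andP[_ yv]; rewrite eq_le vy.
have [|p p_path p_last] := IH x z _ (ltW xz).
  by apply: sub_n => //; [exact: ltW|rewrite (lt_eqF zy) orbT].
have [|q q_path q_last] := IH z y _ (ltW zy).
  by apply: sub_n => //; [exact: ltW|rewrite (gt_eqF xz)].
by exists (p ++ q); rewrite ?cat_path ?last_cat p_last // p_path.
Qed.

Lemma cover_path_min v p x : path (@covers _ P) v p -> x \in v :: p -> v <= x.
Proof.
move=> vp; rewrite inE => /predU1P[->//|xp]; apply: ltW.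
have: path <%O v p by apply: sub_path vp => a b /covers_lt.
by move=> /(order_path_min lt_trans)/allP; apply.
Qed.

Lemma cover_path_comparable v p x y :
  path (@covers _ P) v p -> x \in v :: p -> y \in v :: p -> x >=< y.
Proof.
elim: p v => [|w p IH] v.
  by rewrite !inE => _ /eqP-> /eqP->; exact: comparablexx.
move=> vp; have [_ wp] := andP vp.
rewrite [x \in _]inE => /predU1P[->|xp] yp.
  by rewrite le_comparable // (cover_path_min vp).
move: yp; rewrite inE => /predU1P[->|yp]; last exact: IH wp xp yp.
by rewrite ge_comparable // (cover_path_min vp) // inE xp orbT.
Qed.

End CoverPaths.

(** * The graph of a path of covers in a diagram *)

Section Drawing.
Context {R : realType} {d : Order.disp_t} {P : finPOrderType d}.
Variables (pos : P -> R * R) (c : P -> P -> R -> R * R).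
Hypothesis pos_diagram : diagram pos c.
Implicit Types (a b v w x y z : P) (p : seq P).

Definition height x := (pos x).2.

Lemma covers_height a b : covers a b -> height a < height b.
Proof.
have [_ curveP _] := pos_diagram.
by move=> /curveP[_ g0 g1 incr]; rewrite /height -g0 -g1; apply: incr;
  rewrite ?lexx ?ltr01.
Qed.

Lemma cover_path_height v p x : path (@covers _ P) v p -> x \in v :: p ->
  height v <= height x.
Proof.
elim: p v => [|w p IH] v; first by rewrite inE => _ /eqP->.
move=> /andP[/covers_height vw wp]; rewrite inE => /predU1P[->//|xp].
exact: le_trans (ltW vw) (IH w wp xp).
Qed.

Lemma height_lt x y : x < y -> height x < height y.
Proof.
move=> xy; have [[|w p]] := cover_path_exists (ltW xy).
  by move=> _ /= xyE; rewrite xyE ltxx in xy.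
move=> /andP[/covers_height xw wp] /= <-; apply: lt_le_trans xw _.
exact: cover_path_height wp (mem_last _ _).
Qed.

Lemma height_le x y : x <= y -> height x <= height y.
Proof. by rewrite le_eqVlt => /predU1P[->//|/height_lt/ltW]. Qed.

(** [G a b] is the horizontal coordinate of the curve of the cover [a], [b], as
    a function of the height. *)
Definition cover_graph (G : P -> P -> R -> R) : Prop :=
  forall a b, covers a b ->
    {within `[height a, height b], continuous (G a b)}%classic /\
    forall y : R, height a <= y <= height b ->
      exists2 t : R, (0 <= t <= 1)%R & c a b t = (G a b y, y).

Lemma cover_graph_exists : exists G, cover_graph G.
Proof.
have [_ curveP _] := pos_diagram.
have /choice[G GP] : forall ab : P * P, exists G : R -> R, covers ab.1 ab.2 ->
    {within `[height ab.1, height ab.2], continuous G}%classic /\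
    forall y : R, height ab.1 <= y <= height ab.2 ->
      exists2 t : R, (0 <= t <= 1)%R & c ab.1 ab.2 t = (G y, y).
  move=> [a b]; case: (boolP (covers a b)) => [ab|_]; last by exists id.
  by have [G GP] := upward_curve_graph (curveP a b ab); exists G.
by exists (fun a b => G (a, b)) => a b; exact: (GP (a, b)).
Qed.

Variable G : P -> P -> R -> R.
Hypothesis G_graph : cover_graph G.

Lemma cover_graph_bot a b : covers a b -> G a b (height a) = (pos a).1.
Proof.
have [_ curveP _] := pos_diagram => ab.
have [_ g0 _ g_incr] := curveP a b ab.
have [_ /(_ (height a))] := G_graph ab.
rewrite lexx ltW ?covers_height // => /(_ isT)[t /andP[t0 t1]].
move: t0; rewrite le_eqVlt => /predU1P[<-|t0]; first by rewrite g0 => ->.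
move=> gt; have := g_incr 0%R t (lexx _) t0 t1.
by rewrite g0 gt ltxx.
Qed.

Lemma cover_graph_top a b : covers a b -> G a b (height b) = (pos b).1.
Proof.
have [_ curveP _] := pos_diagram => ab.
have [_ _ g1 g_incr] := curveP a b ab.
have [_ /(_ (height b))] := G_graph ab.
rewrite lexx ltW ?covers_height // => /(_ isT)[t /andP[t0 t1]].
move: t1; rewrite le_eqVlt => /predU1P[->|t1]; first by rewrite g1 => ->.
move=> gt; have := g_incr t 1%R t0 t1 (lexx _).
by rewrite g1 gt ltxx.
Qed.

(** Each cover contributes its half-open range of heights, so that the last
    vertex is the only one whose value is not taken from an outgoing curve. *)
Fixpoint path_graph v p (y : R) : R :=
  if p is w :: p' then
    if (y < height w)%R then G v w y else path_graph w p' y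
  else (pos v).1.

Lemma path_graph_vertex v p x : path (@covers _ P) v p -> x \in v :: p ->
  path_graph v p (height x) = (pos x).1.
Proof.
elim: p v => [|w p IH] v; first by rewrite inE => _ /eqP->.
move=> /andP[vw wp]; rewrite inE => /predU1P[->|xp] /=.
  by rewrite covers_height // cover_graph_bot.
by rewrite ltNge (cover_path_height wp xp) /= IH.
Qed.

(** Two vertices of a path of covers that form a cover are consecutive on the
    path, so that membership alone identifies the edges of the path. *)
Lemma path_graph_cover v p a b (y : R) : path (@covers _ P) v p ->
    a \in v :: p -> b \in v :: p -> covers a b -> height a <= y <= height b ->
  path_graph v p y = G a b y.
Proof.
elim: p v => [|w p IH] v.
  by rewrite !inE => _ /eqP-> /eqP-> /covers_lt; rewrite ltxx.
move=> vp; have /andP[vw wp] := vp; rewrite inE => /predU1P[->|ap].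
  rewrite inE => /predU1P[-> /covers_lt|bp vb /andP[_ yb]]; first by rewrite ltxx.
  have := cover_path_min wp bp; rewrite le_eqVlt => /predU1P[wb|wb].
    rewrite wb /=; case: ltP => // by'; have -> : y = height b.
      by apply/eqP; rewrite eq_le yb.
    by rewrite path_graph_vertex ?mem_head -?wb // wb cover_graph_top.
  by case: (covers_between vb (covers_lt vw) wb).
rewrite inE => /predU1P[->|bp] ab ayb.
  have := lt_le_trans (covers_lt vw) (cover_path_min wp ap).
  by rewrite lt_gtF // covers_lt.
rewrite /= ltNge (le_trans (cover_path_height wp ap)) ?(andP ayb).1 //=.
exact: IH.
Qed.

Lemma path_graph_on_cover v p (y : R) : path (@covers _ P) v p ->
    height v <= y <= height (last v p) -> p != [::] ->
  exists a b, [/\ a \in v :: p, b \in v :: p, covers a b & height a <= y <= height b].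
Proof.
elim: p v => // w p IH v /andP[vw wp] /= /andP[vy yl] _.
have [yw|/ltW wy] := leP y (height w).
  by exists v, w; rewrite !inE !eqxx orbT vy yw.
case: p => [|u p] in IH wp yl *.
  by exists v, w; rewrite !inE !eqxx orbT vy.
have [|//|a [b [ap bp ab ayb]]] := IH w wp; first by rewrite wy.
by exists a, b; split=> //; rewrite in_cons ?ap ?bp orbT.
Qed.

(** The pieces agree at the common vertex of two consecutive covers. *)
Lemma path_graph_continuous v p : path (@covers _ P) v p ->
  {within `[height v, height (last v p)], continuous (path_graph v p)}%classic.
Proof.
elim: p v => [|w p IH] v /=.
  move=> _; apply: continuous_subspaceT => x; exact: cvg_cst.
move=> /andP[vw wp]; have vwh := covers_height vw.
have wl : height w <= height (last w p).
  exact: cover_path_height wp (mem_last _ _).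
have -> : `[height v, height (last w p)]%classic =
    (`[height v, height w] `|` `[height w, height (last w p)])%classic.
  apply/seteqP; split=> y /=; rewrite !in_itv /=.
    case/andP=> vy yl; case: (leP y (height w)) => [yw|/ltW wy].
      by left; rewrite vy.
    by right; rewrite wy.
  case=> /andP[ay yb]; first by rewrite ay (le_trans yb).
  by rewrite yb andbT (le_trans (ltW vwh)).
apply: withinU_continuous; [exact: itv_closed|exact: itv_closed| |].
  apply: subspace_eq_continuous (G_graph vw).1 => y.
  rewrite inE /= in_itv /= => /andP[_ yw]; rewrite /from_subspace /=.
  case: (@ltP _ R y (height w)) => // wy.
  have -> : y = height w by apply: (@le_anti _ R); rewrite yw wy.
  by rewrite cover_graph_top // path_graph_vertex ?mem_head.
apply: subspace_eq_continuous (IH w wp) => y.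
by rewrite inE /= in_itv /= => /andP[wy _]; rewrite /from_subspace /= ltNge wy.
Qed.

(** * Maximal chains of a planar order *)

Hypothesis pos_planar : crossing_free pos c.
Variables zero one : P.
Hypothesis zero_le : forall x, zero <= x.
Hypothesis le_one : forall x, x <= one.
Implicit Types (C D E : seq P) (s t u : R).

(** A maximal chain is the path [C] of covers that leads from [zero] to [one];
    [zero] itself is not an entry of [C]. *)
Definition on_chain C x : Prop :=
  [/\ path (@covers _ P) zero C, last zero C = one & x \in zero :: C].

Local Notation graph := (path_graph zero).

Lemma chain_exists x y : x <= y -> exists C, on_chain C x /\ on_chain C y.
Proof.
move=> xy; have [p p_path p_last] := cover_path_exists (zero_le x).
have [q q_path q_last] := cover_path_exists xy.
have [r r_path r_last] := cover_path_exists (le_one y).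
have pqr_path : path (@covers _ P) zero (p ++ q ++ r).
  by rewrite !cat_path p_path p_last q_path q_last.
have pqr_last : last zero (p ++ q ++ r) = one.
  by rewrite !last_cat p_last q_last.
exists (p ++ q ++ r); split; split => //.
  by rewrite -cat_cons mem_cat -p_last mem_last.
rewrite catA -cat_cons mem_cat; apply/orP; left.
by rewrite -q_last -p_last -last_cat mem_last.
Qed.

Lemma chain_comparable C x y : on_chain C x -> on_chain C y -> x >=< y.
Proof. by move=> [C_path _ xC] [_ _ yC]; exact: cover_path_comparable C_path xC yC. Qed.

Lemma chain_le C x y : on_chain C x -> on_chain C y ->
  height x <= height y -> x <= y.
Proof.
move=> xC yC xy; have /orP[//|] := chain_comparable xC yC.
rewrite le_eqVlt => /predU1P[->//|/height_lt].
by rewrite ltNge xy.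
Qed.

Lemma chain_lt C x y : on_chain C x -> on_chain C y ->
  height x < height y -> x < y.
Proof.
move=> xC yC xy; rewrite lt_neqAle (chain_le xC yC (ltW xy)) andbT.
by apply: contraTneq xy => ->; rewrite ltxx.
Qed.

Lemma chain_graph C x : on_chain C x -> graph C (height x) = (pos x).1.
Proof. by case=> C_path _ xC; exact: path_graph_vertex. Qed.

Lemma height_range x : height zero <= height x <= height one.
Proof. by rewrite !height_le. Qed.

Lemma chain_cover_at C x u : on_chain C x ->
    height zero <= u <= height one -> height zero < height one ->
  exists a b, [/\ on_chain C a, on_chain C b, covers a b,
    height a <= u <= height b & exists2 t, (0 <= t <= 1)%R & c a b t = (graph C u, u)].
Proof.
move=> [C_path C_last _] u01 lt01.
have [||a [b [aC bC ab aub]]] := path_graph_on_cover C_path (y := u).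
- by rewrite C_last.
- by apply: contraTneq lt01 => C0; rewrite -C_last C0 ltxx.
exists a, b; split=> //; rewrite (path_graph_cover C_path aC bC ab aub).
by have [_] := G_graph ab; apply.
Qed.

(** By the definition of a diagram, a curve passes through no vertex other than
    its two ends. *)
Lemma graph_on_chain C D x : on_chain D one -> on_chain C x ->
  graph D (height x) = (pos x).1 -> on_chain D x.
Proof.
move=> oneD xC Dx.
have [lt01|] := boolP (height zero < height one); last first.
  move=> nlt01; suff -> : x = one by [].
  apply/eqP; rewrite -[_ == _]negbK; apply: contra nlt01 => xone.
  by apply: height_lt; rewrite (le_lt_trans (zero_le x)) // lt_neqAle xone le_one.
have [a [b [aD bD ab _ [t t01]]]] := chain_cover_at oneD (height_range x) lt01.
have [_ _ vertexP] := pos_diagram.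
have -> : (graph D (height x), height x) = pos x.
  by rewrite Dx /height -surjective_pairing.
by move=> /(vertexP _ _ _ _ ab t01)[] ->.
Qed.

(** The graphs meet at some height [u] by the intermediate value theorem.  If
    the covers of [C] and [D] at height [u] differ, then planarity makes the
    meeting point a common vertex.  If they coincide, the graphs agree on the
    whole cover, so its range of heights does not contain [s], and its end
    towards [s] is the desired vertex. *)
Lemma graphs_cross C D s t : on_chain C one -> on_chain D one ->
    height zero <= s <= height one -> height zero <= t <= height one ->
    graph C s < graph D s -> graph D t <= graph C t ->
  exists v, [/\ on_chain C v, on_chain D v &
    (s < height v <= t) || (t <= height v < s)].
Proof.
move=> oneC oneD s01 t01 CDs DCt.
have [C_path C_last _] := oneC; have [D_path D_last _] := oneD.
have st : s != t by apply: contraTneq CDs => ->; rewrite -leNgt.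
have lt01 : height zero < height one.
  case/andP: s01 => zs so; case/andP: t01 => zt to.
  have := st; rewrite neq_lt => /orP[st'|ts].
    exact: le_lt_trans zs (lt_le_trans st' to).
  exact: le_lt_trans zt (lt_le_trans ts so).
have cont E (a b : R) : on_chain E one -> height zero <= a <= height one ->
    height zero <= b <= height one -> {within `[a, b], continuous (graph E)}%classic.
  move=> [E_path E_last _] /andP[a0 _] /andP[_ b1].
  apply: continuous_subspaceW (path_graph_continuous E_path) => y.
  rewrite E_last /= !in_itv /= => /andP[ay yb].
  by rewrite (le_trans a0 ay) (le_trans yb b1).
have [u u_st CDu] : exists2 u, (s <= u <= t) || (t <= u <= s) & graph C u = graph D u.
  have := st; rewrite neq_lt => /orP[/ltW st'|/ltW ts].
    have [u ust CDu] := IVT_meet (cont _ _ _ oneC s01 t01) (cont _ _ _ oneD s01 t01)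
      st' (ltW CDs) DCt.
    by exists u; rewrite // ust.
  have [u ust CDu] := IVT_meet (cont _ _ _ oneD t01 s01) (cont _ _ _ oneC t01 s01)
      ts DCt (ltW CDs).
  by exists u; rewrite // ust orbT.
have u_s : u != s by apply: contraTneq CDs => <-; rewrite CDu ltxx.
have u01 : height zero <= u <= height one.
  case/andP: s01 => zs so; case/andP: t01 => zt to.
  case/orP: u_st => /andP[lu ul].
    by rewrite (le_trans zs lu) (le_trans ul to).
  by rewrite (le_trans zt lu) (le_trans ul so).
have [a [b [aC bC ab aub [tc tc01 ctc]]]] := chain_cover_at oneC u01 lt01.
have [a' [b' [aD bD ab' aub' [td td01 ctd]]]] := chain_cover_at oneD u01 lt01.
have [[aE bE]|ab_neq] := eqVneq (a, b) (a', b').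
  rewrite -aE -bE in aD bD.
  have s_out : ~ (height a <= s <= height b).
    have [_ _ aC'] := aC; have [_ _ bC'] := bC.
    have [_ _ aD'] := aD; have [_ _ bD'] := bD.
    move=> asb; move: CDs.
    rewrite (path_graph_cover C_path aC' bC' ab asb).
    by rewrite (path_graph_cover D_path aD' bD' ab asb) ltxx.
  case/andP: aub => au ub; case/orP: u_st => /andP[lu ul].
    exists a; split=> //; apply/orP; left; rewrite (le_trans au ul) andbT.
    by rewrite ltNge; apply/negP => as'; apply: s_out; rewrite as' (le_trans lu ub).
  exists b; split=> //; apply/orP; right; rewrite (le_trans lu ub) /=.
  by rewrite ltNge; apply/negP => sb; apply: s_out; rewrite sb (le_trans au ul).
have [||v [v_ab v_ab' vE]] := pos_planar ab ab' _ tc01 td01; first exact/eqP.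
  by rewrite ctc ctd CDu.
have hv : height v = u by rewrite /height -vE ctc.
exists v; split.
- by case: v_ab => ->.
- by case: v_ab' => ->.
- rewrite hv; case/orP: u_st => /andP[lu ul]; apply/orP; [left|right].
    by rewrite lt_neqAle eq_sym u_s lu.
  by rewrite lu lt_neqAle u_s.
Qed.

Lemma graph_top_chain C x : on_chain C x -> on_chain C one.
Proof. by case=> C_path C_last _; split; rewrite // -C_last mem_last. Qed.

Definition between x y u :=
  (height x <= u <= height y) || (height y <= u <= height x).

Lemma between_range x y u : between x y u -> height zero <= u <= height one.
Proof.
case/andP: (height_range x) => x0 x1; case/andP: (height_range y) => y0 y1.
case/orP=> /andP[lu ul]; first by rewrite (le_trans x0 lu) (le_trans ul y1).
by rewrite (le_trans y0 lu) (le_trans ul x1).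
Qed.

Lemma between_l x y : between x y (height x).
Proof. by rewrite /between !lexx /= andbT; exact: le_total. Qed.

Lemma between_r x y : between x y (height y).
Proof. by rewrite /between !lexx /= andbT; exact: le_total. Qed.

(** At a change of sides the chains would share a vertex [v] with height between
    those of [x] and [y].  Being on a chain with [x] and on a chain with [y],
    it would make [x] and [y] comparable. *)
Lemma graphs_same_side C D x y s t : x >< y -> on_chain C x -> on_chain D y ->
  between x y s -> between x y t -> graph C s < graph D s -> graph C t < graph D t.
Proof.
move=> xy xC yD xys xyt CDs; rewrite ltNge; apply/negP => DCt.
have [v [vC vD vst]] := graphs_cross (graph_top_chain xC) (graph_top_chain yD)
  (between_range xys) (between_range xyt) CDs DCt.
have {vst} vxy : between x y (height v).
  move: xys xyt vst; rewrite /between.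
  case/orP=> /andP[? ?] /orP[] /andP[? ?] /orP[] /andP[? ?]; apply/orP; lra.
move/negP: xy; apply; apply/orP; case/orP: vxy => /andP[lv vl]; [left|right].
  exact: le_trans (chain_le xC vC lv) (chain_le vD yD vl).
exact: le_trans (chain_le yD vD lv) (chain_le vC xC vl).
Qed.

(** * The left-to-right order *)

Definition left x y : bool :=
  `[< x >< y /\ exists2 D, on_chain D y & (pos x).1 < graph D (height x) >].

Lemma left_incomparable x y : left x y -> x >< y.
Proof. by case/asboolP. Qed.

(** The defining chain through [y] can be replaced by any other: comparing at
    the height of [y], where all chains through [y] agree, and moving to the
    height of [x] does not change sides. *)
Lemma left_graph x y C D u : left x y -> on_chain C x -> on_chain D y ->
  between x y u -> graph C u < graph D u.
Proof.
move=> /asboolP[xy [E yE xltE]] xC yD xyu; have [bl br] := (between_l x y, between_r x y).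
apply: (graphs_same_side xy xC yD br xyu); rewrite (chain_graph yD) -(chain_graph yE).
by apply: (graphs_same_side xy xC yE bl br); rewrite (chain_graph xC).
Qed.

Lemma graph_left x y C D u : x >< y -> on_chain C x -> on_chain D y ->
  between x y u -> graph C u < graph D u -> left x y.
Proof.
move=> xy xC yD xyu CDu; apply/asboolP; split=> //; exists D => //.
rewrite -(chain_graph xC).
exact: (graphs_same_side xy xC yD xyu (between_l x y)).
Qed.

(** A chain through [y] misses [x], so it passes [x] on one side. *)
Lemma left_total x y : x >< y -> left x y || left y x.
Proof.
move=> xy; have [C [xC _]] := chain_exists (lexx x).
have [D [yD _]] := chain_exists (lexx y).
have [lt|gt|eq] := ltgtP (graph C (height x)) (graph D (height x)).
- by rewrite (graph_left xy xC yD (between_l x y) lt).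
- by rewrite orbC (graph_left _ yD xC (between_r y x) gt) // comparable_sym.
- have xD : on_chain D x.
    apply: (graph_on_chain (graph_top_chain yD) xC).
    by rewrite -eq chain_graph.
  by rewrite (chain_comparable xD yD) in xy.
Qed.

(** At the height of [y], the chain [E] would be both to the left and to the
    right of [y]. *)
Lemma left_not_around_chain x y z E :
  left x y -> left y z -> on_chain E x -> on_chain E z -> False.
Proof.
move=> xy yz xE zE; have [D [yD _]] := chain_exists (lexx y).
have := left_graph xy xE yD (between_r x y).
by rewrite lt_gtF // (left_graph yz yD zE (between_l y z)).
Qed.

(** Among the three elements take the one of middle height.  At its height the
    chains through the three elements can all be compared, and the comparisons
    would be cyclic. *)
Lemma left_acyclic x y z : left x y -> left y z -> left z x -> False.
Proof.
have mid a b e : left a b -> left b e -> left e a -> between a e (height b) -> False.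
  move=> ab be ea aeb; have [A [aA _]] := chain_exists (lexx a).
  have [B [bB _]] := chain_exists (lexx b); have [E [eE _]] := chain_exists (lexx e).
  have AB := left_graph ab aA bB (between_r a b).
  have BE := left_graph be bB eE (between_l b e).
  have := lt_trans AB BE; rewrite lt_gtF //.
  by apply: (left_graph ea eE aA); rewrite /between orbC.
move=> xy yz zx.
have [|] := boolP (between x z (height y)); first exact: mid xy yz zx.
have [|] := boolP (between y x (height z)); first by move=> h _; exact: mid yz zx xy h.
have [|] := boolP (between z y (height x)); first by move=> h _ _; exact: mid zx xy yz h.
rewrite /between; move: (height x) (height y) (height z) => hx hy hz.
by case: (leP hx hy); case: (leP hy hz); case: (leP hx hz); lra.
Qed.

Definition left_order x y := (x < y) || left x y.

(** Transitivity: if [x] does not precede [z], then [z <= x] or [z] is left of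
    [x].  If [left] holds once among the three relations, this makes its two
    arguments comparable; if twice, a chain through two of the elements has the
    third on both sides; if three times, [left] has a cycle. *)
Lemma left_order_linear : linear_extension left_order.
Proof.
have order_or x y : [\/ left_order x y, y <= x | left y x].
  have [xy|/left_total] := boolP (x >=< y).
    have [xy'|yx] := comparable_ltP xy; last by constructor 2.
    by constructor 1; rewrite /left_order xy'.
  by case/orP=> [xy|yx]; [constructor 1; rewrite /left_order xy orbT|constructor 3].
split.
- move=> x; rewrite /left_order ltxx /=; apply/negP => /left_incomparable.
  by rewrite comparablexx.
- move=> y x z xy yz; have [//|zx|zx] := order_or x z; exfalso.
    case/orP: xy => [xy|xy]; case/orP: yz => [yz|yz].
    + by rewrite (lt_geF (lt_trans xy yz)) in zx.
    + have := left_incomparable yz.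
      by rewrite ge_comparable // (le_trans zx (ltW xy)).
    + have := left_incomparable xy.
      by rewrite ge_comparable // (le_trans (ltW yz) zx).
    + have [E [zE xE]] := chain_exists zx.
      exact: left_not_around_chain xy yz xE zE.
  case/orP: xy => [xy|xy]; case/orP: yz => [yz|yz].
  + have := left_incomparable zx.
    by rewrite ge_comparable // ltW // (lt_trans xy).
  + have [E [xE yE]] := chain_exists (ltW xy).
    exact: left_not_around_chain yz zx yE xE.
  + have [E [yE zE]] := chain_exists (ltW yz).
    exact: left_not_around_chain zx xy zE yE.
  + exact: left_acyclic xy yz zx.
- move=> x y xy; rewrite /left_order.
  have [xy'|/left_total/orP[->|->]] := boolP (x >=< y); rewrite ?orbT //.
  case/orP: xy'; rewrite le_eqVlt; first by rewrite (negPf xy) => /= ->.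
  by rewrite eq_sym (negPf xy) /= => ->; rewrite !orbT.
- by move=> x y xy; rewrite /left_order xy.
Qed.

(** * Crossings and joins at a cover *)

(** The common vertex provided by [graphs_cross] would lie strictly between [a]
    and [b] in the order. *)
Lemma cover_no_switch a b C D : covers a b -> on_chain C a ->
    on_chain C b \/ on_chain D b -> on_chain D one ->
    graph C (height a) < graph D (height a) /\
      graph D (height b) < graph C (height b) \/
    graph D (height a) < graph C (height a) /\
      graph C (height b) < graph D (height b) ->
  False.
Proof.
move=> ab aC bCD oneD switch.
have oneC := graph_top_chain aC.
have [v [vC vD avb]] : exists v, [/\ on_chain C v, on_chain D v &
    (height a < height v <= height b) || (height b <= height v < height a)].
  case: switch => -[swa swb].
    exact: graphs_cross (height_range a) (height_range b) swa (ltW swb).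
  have [v [vD vC avb]] :=
    graphs_cross oneD oneC (height_range a) (height_range b) swa (ltW swb).
  by exists v.
have {avb} /andP[av vb] : height a < height v < height b.
  have ab_h := covers_height ab.
  have vb : height v != height b.
    apply/eqP => vb; move: switch; rewrite -vb (chain_graph vC) (chain_graph vD) ltxx.
    by case=> -[].
  case/orP: avb => /andP[av vb'].
    by rewrite av lt_neqAle vb.
  by have := lt_trans (lt_le_trans ab_h av) vb'; rewrite ltxx.
apply: (covers_between ab (chain_lt aC vC av)).
by case: bCD => [bC|bD]; [exact: chain_lt vC bC vb|exact: chain_lt vD bD vb].
Qed.

Lemma left_order_nocross a b a' b' : covers a b -> covers a' b' ->
  left_order a a' -> left_order b' b -> a < a' \/ b' < b.
Proof.
move=> ab ab' /orP[|aa']; first by left.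
move=> /orP[|bb']; first by right.
have [C [aC bC]] := chain_exists (ltW (covers_lt ab)).
have [D [aD bD]] := chain_exists (ltW (covers_lt ab')).
case: (cover_no_switch ab aC (or_introl bC) (graph_top_chain aD)); left; split.
  exact: left_graph aa' aC aD (between_l _ _).
exact: left_graph bb' bD bC (between_r _ _).
Qed.

(** Otherwise [y] and [b] are incomparable.  Of the two pairs of chains, one
    through [a], [b] and one through [x], [y], or one through [a], [y] and one
    through [x], [b], one pair swaps sides between the heights of [a] and [b]:
    the first if [x] and [y] are on opposite sides of the cover, the second if
    they are on the same side. *)
Lemma cover_join a b x y : covers a b -> x < b -> x >< a -> a <= y -> x <= y ->
  b <= y.
Proof.
move=> ab xb xa ay xy; have [//|nby] := boolP (b <= y); exfalso.
have ay' : a < y.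
  rewrite lt_neqAle ay andbT; apply: contraNneq xa => ->.
  by rewrite le_comparable.
have yb : y >< b.
  apply/negP => /orP[|by']; last by rewrite by' in nby.
  rewrite le_eqVlt => /predU1P[yb|]; first by rewrite yb lexx in nby.
  exact: covers_between ab ay'.
have xa' : a >< x by rewrite comparable_sym.
have by' : b >< y by rewrite comparable_sym.
case/orP: (left_total xa') => [ax|{}xa]; case/orP: (left_total yb) => [{}yb|{}by'].
- have [C [aC bC]] := chain_exists (ltW (covers_lt ab)).
  have [D [xD yD]] := chain_exists xy.
  apply: (cover_no_switch ab aC (or_introl bC) (graph_top_chain xD)); left; split.
    exact: left_graph ax aC xD (between_l _ _).
  exact: left_graph yb yD bC (between_r _ _).
- have [C [aC yC]] := chain_exists ay.
  have [D [xD bD]] := chain_exists (ltW xb).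
  apply: (cover_no_switch ab aC (or_intror bD) (graph_top_chain xD)); left; split.
    exact: left_graph ax aC xD (between_l _ _).
  exact: left_graph by' bD yC (between_l _ _).
- have [C [aC yC]] := chain_exists ay.
  have [D [xD bD]] := chain_exists (ltW xb).
  apply: (cover_no_switch ab aC (or_intror bD) (graph_top_chain xD)); right; split.
    exact: left_graph xa xD aC (between_r _ _).
  exact: left_graph yb yC bD (between_r _ _).
- have [C [aC bC]] := chain_exists (ltW (covers_lt ab)).
  have [D [xD yD]] := chain_exists xy.
  apply: (cover_no_switch ab aC (or_introl bC) (graph_top_chain xD)); right; split.
    exact: left_graph xa xD aC (between_r _ _).
  exact: left_graph by' bC yD (between_l _ _).
Qed.

End Drawing.

Lemma queue_layout_planar (R : realType) (d : Order.disp_t) (P : finPOrderType d) :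
  planar R P -> has_zero_one P -> queue_layout P (width P).
Proof.
move=> [pos [c [pos_diagram pos_planar]]] [[zero zero_le] [one le_one]].
have [G G_graph] := cover_graph_exists pos_diagram.
apply: (@queue_layout_planar_lattice _ _ (left_order pos G zero one)).
- exact: (left_order_linear pos_diagram G_graph pos_planar zero_le le_one).
- exact: (left_order_nocross pos_diagram G_graph pos_planar zero_le le_one).
- exact: (cover_join pos_diagram G_graph pos_planar zero_le le_one).
Qed.

(** * Queue-number and width *)

Theorem corollary2 (R : realType) (d : Order.disp_t) (P : finPOrderType d)
  (P_nonempty : (0 < #|P|)%N)
  (hP : interval_order R P \/ series_parallel P
        \/ (planar R P /\ has_zero_one P)) :
  (queue_number P <= width P)%N.
Proof.
apply: queue_number_le; case: hP => [|[|[]]].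
- by move=> /interval_order_cover_downset; exact: queue_layout_down_rel.
- by move=> /series_parallel_cover_downset; exact: queue_layout_down_rel.
- exact: queue_layout_planar.
Qed.
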